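(* For every admissible pair $(G,\mu)$ with $G$ non-amenable there exist positive real numbers $A$, $a<1$, $B$, $b<1-a$ such that condition $\mathsf B_{A,a,B,b}$ holds.
   Context: An admissible pair $(G,\mu)$ is a group $G$ with a probability measure $\mu$ on $G$ that is symmetric ($\mu(g)=\mu(g^{-1})$), has finite support $\mathcal S=\operatorname{supp}\mu=\{g:\mu(g)>0\}$, and such that $\mathcal S$ generates $G$. Denote by $\boldsymbol\iota$ the neutral element of $G$. Let $\langle\mathcal S\rangle$ be the free monoid on $\mathcal S$ (words, including the empty word), $\ell_\psi$ the length of a word $\psi$, $\boldsymbol\pi:\langle\mathcal S\rangle\to G$ the evaluation homomorphism, and $|g|=\min\{\ell_\psi:\boldsymbol\pi(\psi)=g\}$ the word norm. The weight of $\psi=s_1\dots s_n$ is $\mu_\psi=\prod_{i=1}^n\mu(s_i)$ (and $1$ for the empty word). The Green function is $\mathrm{Gr}_\mu(g)=\sum\{\mu_\psi:\psi\in\boldsymbol\pi^{-1}(g)\}$; it is finite for every $g$ when $G$ is non-amenable. $\mathbb P_{\boldsymbol\iota,g}$ is the probability measure on $\boldsymbol\pi^{-1}(g)$ with $\mathbb P_{\boldsymbol\iota,g}\{\psi\}=\mu_\psi/\mathrm{Gr}_\mu(g)$. Condition $\mathsf A_{A,a}$ ($A>0$, $0<a<1$): for every real $c\geqslant1$ and every $g\in G$ with $|g|\leqslant c$, $\mathbb P_{\boldsymbol\iota,g}\{\psi:\ell_\psi\geqslant Ac\}\leqslant a$. Condition $\mathsf B_{A,a,B,b}$ ($B,b>0$):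 $\mathsf A_{A,a}$ holds, $b<1-a$, and for every real $c\geqslant1$ and every $g\in G$ with $|g|\leqslant c$, $\mathbb P_{\boldsymbol\iota,g}\{\psi:\ell_\psi\geqslant Bc\}\leqslant\dfrac{b}{2(AB+B+2)}$. *)

(* Defs.v *)
From HB Require Import structures.
From mathcomp Require Import all_boot all_order all_algebra.
From mathcomp Require Import all_classical all_reals all_analysis.

Set Implicit Arguments.
Unset Strict Implicit.
Unset Printing Implicit Defensive.

Import Order.TTheory GRing.Theory Num.Theory.

Local Open Scope classical_set_scope.
Local Open Scope ring_scope.

(* Amenability of a discrete group (von Neumann): existence of a finitely
   additive left-invariant probability measure defined on all subsets. *)
Definition amenable (R : realType) (G : groupType) : Prop :=
  exists m : set G -> R,
    [/\ forall X, 0 <= m X,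
        m [set: G] = 1,
        forall X Y, X `&` Y = set0 -> m (X `|` Y) = m X + m Y
      & forall (g : G) X, m [set (g * x)%g | x in X] = m X].

Section AdmissiblePairs.
Variables (R : realType) (G : groupType) (mu : G -> R).

Definition msupp : set G := [set g | 0 < mu g].

(* No proper subgroup contains X; for symmetric X this amounts to every
   element of G being a product of elements of X. *)
Definition generates (X : set G) : Prop :=
  forall H : {pred G}, group_closed H -> (forall x, X x -> x \in H) ->
    forall g, g \in H.

(* The probability measure on G is given by its point masses. *)
Definition admissible : Prop :=
  [/\ forall g, 0 <= mu g,
      (\esum_(g in [set: G]) (mu g)%:E = 1)%E,
      forall g, mu g = mu (g^-1)%g,
      finite_set msupp
    & generates msupp].

Definition words : set (seq G) := [set w | forall s, s \in w -> msupp s].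

Definition word_eval (w : seq G) : G := (\prod_(s <- w) s)%g.

Definition word_fiber (g : G) : set (seq G) :=
  words `&` [set w | word_eval w = g].

(* The value 0 is a default, used only if no word represents g. *)
Definition word_norm (g : G) : nat :=
  xget 0%N [set n | (exists2 w, word_fiber g w & size w = n) /\
                    (forall w, word_fiber g w -> (n <= size w)%N)].

Definition weight (w : seq G) : R := \prod_(s <- w) mu s.

Definition Green (g : G) : \bar R :=
  (\esum_(w in word_fiber g) (weight w)%:E)%E.

(* The measure P_{1,g} on word_fiber g, evaluated at word_fiber g `&` E.  It is
   a probability measure as soon as Green g is finite (and nonzero). *)
Definition path_prob (g : G) (E : set (seq G)) : \bar R :=
  (\esum_(w in word_fiber g `&` E) ((weight w)%:E / Green g))%E.

(* Finiteness of the Green function is included because the probability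
   measures P_{1,g} exist only under this assumption: in \bar R one has
   x / +oo = 0, which would make the bounds below void. *)
Definition condA (A a : R) : Prop :=
  [/\ 0 < A, 0 < a < 1,
      forall g, (Green g < +oo)%E
    & forall (c : R) (g : G), 1 <= c -> (word_norm g)%:R <= c ->
        (path_prob g [set w | (A * c <= (size w)%:R)%R] <= a%:E)%E].

Definition condB (A a B b : R) : Prop :=
  [/\ 0 < B, 0 < b, condA A a, b < 1 - a
    & forall (c : R) (g : G), 1 <= c -> (word_norm g)%:R <= c ->
        (path_prob g [set w | (B * c <= (size w)%:R)%R]
           <= (b / (2 * (A * B + B + 2)))%:E)%E].

End AdmissiblePairs.

(* Main.v *)
(** The proof rests on Kesten's theorem. Let [P] be the convolution operator of
    [mu] on finitely supported functions. If [P] has [l^2]-norm 1, some [f_k]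
    are almost [P]-invariant in [l^2], hence all their translates by elements of
    the support are close to each other, and an ultralimit of the probability
    weights [f_k ^+ 2] yields an invariant mean. So for a nonamenable group the
    [n]-step transition probabilities are at most [rho ^+ n] with [rho < 1].
    The words of length at least [M] thus contribute at most
    [rho ^+ M / (1 - rho)] to the Green function, which is itself at least
    [e ^+ |g|], where [e] is the least mass of a point of the support. With
    [M = A c] and [|g| <= c] the quotient is small once [A] is large; and
    [rho ^+ B] beats the factor linear in [B] in the second condition. *)

Require Import Defs.
From HB Require Import structures.
From mathcomp Require Import all_boot all_order all_algebra.
From mathcomp Require Import all_classical all_reals all_analysis.
From mathcomp Require Import finmap lra.
Import Order.TTheory GRing.Theory Num.Theory.
Import numFieldNormedType.Exports.
Local Open Scope classical_set_scope.
Local Open Scope ring_scope.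

Set Implicit Arguments.
Unset Strict Implicit.
Unset Printing Implicit Defensive.

(** * Sums of finitely supported functions *)

Section FiniteSupport.
Context {R : realType} {T : choiceType}.
Implicit Types f g : T -> R.

Definition finsupp f := finite_set (f @^-1` [set~ 0]).

(** An infinite support gives the default value 0, so additivity and monotonicity carry [finsupp]
    hypotheses. *)
Definition tsum f : R := \sum_(x \in [set: T]) f x.

Lemma finsuppD f g : finsupp f -> finsupp g -> finsupp (fun x => f x + g x).
Proof.
move=> ff fg; have := conj ff fg; rewrite -finite_setU.
apply: sub_finite_set => x /= fgx; apply: contrapT => /not_orP[f0 g0].
by apply: fgx; rewrite (contrapT f0) (contrapT g0) addr0.
Qed.

Lemma finsuppMl f g : finsupp f -> finsupp (fun x => g x * f x).
Proof. by apply: sub_finite_set => x /= + f0; apply; rewrite f0 mulr0. Qed.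

Lemma finsuppX f n : finsupp f -> finsupp (fun x => f x ^+ n.+1).
Proof. by move=> ff; under eq_fun do rewrite exprSr; exact: finsuppMl. Qed.

Lemma finsuppB f g : finsupp f -> finsupp g -> finsupp (fun x => f x - g x).
Proof.
move=> ff fg; apply: finsuppD => //.
by under eq_fun do rewrite -mulN1r; exact: finsuppMl.
Qed.

Lemma finsupp_sum (I : Type) (r : seq I) (F : I -> T -> R) :
  (forall i, finsupp (F i)) -> finsupp (fun x => \sum_(i <- r) F i x).
Proof.
move=> fF; elim: r => [|i r IH].
  by apply: (sub_finite_set _ (finite_set0 T)) => x /=; rewrite big_nil; apply.
by under eq_fun do rewrite big_cons; exact: finsuppD.
Qed.

Lemma finsupp_inj f (h : T -> T) : injective h -> finsupp f -> finsupp (f \o h).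
Proof.
move=> hinj ff; rewrite /finsupp comp_preimage; apply: finite_preimage => //.
by move=> x y _ _; exact: hinj.
Qed.

Lemma tsum_fset f (A : {fset T}) :
  (forall x, x \notin A -> f x = 0) -> tsum f = \sum_(x <- A) f x.
Proof. exact: fsbigTE. Qed.

Lemma finsuppP f : finsupp f ->
  exists A : {fset T}, forall x, x \notin A -> f x = 0.
Proof.
move=> ff; exists (fset_set (f @^-1` [set~ 0])) => x.
by rewrite in_fset_set// notin_setE => /contrapT.
Qed.

Lemma finsuppP2 f g : finsupp f -> finsupp g -> exists A : {fset T},
  (forall x, x \notin A -> f x = 0) /\ (forall x, x \notin A -> g x = 0).
Proof.
move=> /finsuppP[A fA] /finsuppP[B gB]; exists (A `|` B)%fset.
by split=> x; rewrite inE negb_or => /andP[xA xB]; [exact: fA|exact: gB].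
Qed.

Lemma tsumD f g : finsupp f -> finsupp g ->
  tsum (fun x => f x + g x) = tsum f + tsum g.
Proof.
move=> ff /(finsuppP2 ff)[A [fA gA]].
rewrite (tsum_fset fA) (tsum_fset gA) -big_split/=.
by apply: tsum_fset => x xA; rewrite fA ?gA ?addr0.
Qed.

Lemma tsumZ f c : tsum (fun x => c * f x) = c * tsum f.
Proof. by rewrite /tsum mulr_fsumr. Qed.

Lemma tsumB f g : finsupp f -> finsupp g ->
  tsum (fun x => f x - g x) = tsum f - tsum g.
Proof.
move=> ff fg; rewrite -mulN1r -tsumZ -tsumD//; last exact: finsuppMl.
by congr tsum; apply/funext => x; rewrite mulN1r.
Qed.

Lemma tsum_sum (I : Type) (r : seq I) (F : I -> T -> R) :
  (forall i, finsupp (F i)) ->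
  tsum (fun x => \sum_(i <- r) F i x) = \sum_(i <- r) tsum (F i).
Proof.
move=> fF; elim: r => [|i r IH].
  by rewrite big_nil /tsum fsbig1// => x _; rewrite big_nil.
rewrite big_cons -IH -tsumD//; last exact: finsupp_sum.
by congr tsum; apply/funext => x; rewrite big_cons.
Qed.

Lemma tsum_ge0 f : (forall x, 0 <= f x) -> 0 <= tsum f.
Proof. by move=> f0; apply: fsumr_ge0. Qed.

Lemma ler_tsum f g : finsupp f -> finsupp g -> (forall x, f x <= g x) ->
  tsum f <= tsum g.
Proof.
move=> ff fg fg_le; rewrite -subr_ge0 -tsumB//.
by apply: tsum_ge0 => x; rewrite subr_ge0.
Qed.

Lemma tsum_reindex f (h : T -> T) : bijective h -> tsum (f \o h) = tsum f.
Proof. by move=> hbij; exact/esym/reindex_fsbigT. Qed.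

Lemma ler_tsum_term f x : finsupp f -> (forall y, 0 <= f y) -> f x <= tsum f.
Proof.
move=> ff f0; rewrite -[f x](_ : tsum (fun y => (y == x)%:R * f y) = _).
  apply: ler_tsum => // [|y]; first exact: finsuppMl.
  by case: eqP => _; rewrite ?mul1r ?mul0r.
rewrite (@tsum_fset _ [fset x]%fset) => [|y].
  by rewrite big_seq_fset1 eqxx mul1r.
by rewrite inE => /negPf ->; rewrite mul0r.
Qed.

End FiniteSupport.

(** * Kesten's theorem *)

(* AM-GM applied to [(a - b) * (a + b)]. *)
Lemma ler_sqrB {R : realFieldType} (a b eta : R) : 0 < eta ->
  `|a ^+ 2 - b ^+ 2| <= eta * (a ^+ 2 + b ^+ 2) + (2 * eta)^-1 * (a - b) ^+ 2.
Proof.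
move=> eta0; set k := (2 * eta)^-1.
have k0 : 0 <= k by rewrite invr_ge0 mulr_ge0// ltW.
have hk : 2 * eta * k = 1 by rewrite mulfV// mulf_neq0// gt_eqF.
have h0 : 0 <= eta * (a - b) ^+ 2 by rewrite mulr_ge0 ?sqr_ge0// ltW.
have E c : k * (a - b + c * eta * (a + b)) ^+ 2 = k * (a - b) ^+ 2 +
    c * (2 * eta * k) * (a ^+ 2 - b ^+ 2) +
    c ^+ 2 * (2 * eta * k) * (eta / 2) * (a + b) ^+ 2 by lra.
have P c : 0 <= k * (a - b + c * eta * (a + b)) ^+ 2.
  by rewrite mulr_ge0// sqr_ge0.
have := P 1; have := P (-1); rewrite !{}E hk sqrrN !expr1n.
by rewrite ler_norml; move=> *; apply/andP; split; lra.
Qed.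

Section Kesten.
Context {R : realType} {G : groupType}.
Variables (mu : G -> R).
Hypothesis mu_adm : admissible mu.
Implicit Types (f : G -> R) (X : set G).

Let S : seq G := fset_set (msupp mu).

(** * The convolution operator and its loss of norm *)

Definition markov f : G -> R :=
  fun x => \sum_(s <- fset_set (msupp mu)) mu s * f (s^-1 * x)%g.

Lemma mem_msupp s : (s \in fset_set (msupp mu)) = (0 < mu s).
Proof.
have [_ _ _ fin _] := mu_adm.
by rewrite in_fset_set//; apply/idP/idP => [/set_mem|/mem_set].
Qed.

Lemma mu_ge0 s : 0 <= mu s. Proof. by have [] := mu_adm. Qed.

Lemma sum_mu : \sum_(s <- S) mu s = 1.
Proof.
have [mu0 mu1 _ fin _] := mu_adm; rewrite -[LHS]/(fine (\sum_(s <- S) mu s)%:E).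
have : (\esum_(g in msupp mu) (mu g)%:E = 1)%E.
  rewrite esum_mkcond -[RHS]mu1; apply: eq_esum => g _.
  case: ifPn => //; rewrite notin_setE /msupp/= => /negP; rewrite -leNgt => g0.
  by congr (_%:E); apply/eqP; rewrite eq_le g0 mu0.
rewrite -[X in esum X]set_mem_set esum_fset => [|//|s _]; last by rewrite lee_fin.
  by rewrite fsbig_finite//= ?set_mem_set// sumEFin => -[].
by rewrite set_mem_set.
Qed.

Lemma msuppV s : s \in S -> (s^-1)%g \in S.
Proof. by have [_ _ + _ _] := mu_adm; rewrite !mem_msupp => <-. Qed.

Lemma finsupp_mull f (g : G) : finsupp f -> finsupp (fun x => f (g * x)%g).
Proof. by apply: finsupp_inj; exact: mulgI. Qed.

Lemma tsum_mull f (g : G) : tsum (fun x => f (g * x)%g) = tsum f.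
Proof.
apply: (@tsum_reindex _ _ f (fun x => (g * x)%g)).
by exists (fun x => (g^-1 * x)%g) => x; rewrite ?mulKg ?mulVKg.
Qed.

Lemma finsupp_markov f : finsupp f -> finsupp (markov f).
Proof. by move=> ff; apply: finsupp_sum => s; apply/finsuppMl/finsupp_mull. Qed.

(* By the variance identity the right-hand side is the sum over all [s] and [t]
   of the terms on the left. *)
Lemma markov_defect f x s t : s \in S -> t \in S ->
  mu s * mu t * (f (s^-1 * x)%g - f (t^-1 * x)%g) ^+ 2 <=
  2 * (\sum_(u <- S) mu u * f (u^-1 * x)%g ^+ 2 - markov f x ^+ 2).
Proof.
move=> sS tS; set F := fun u => f (u^-1 * x)%g.
have -> : 2 * (\sum_(u <- S) mu u * F u ^+ 2 - markov f x ^+ 2) =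
    \sum_(u <- S) \sum_(v <- S) mu u * mu v * (F u - F v) ^+ 2.
  have E u v : mu u * mu v * (F u - F v) ^+ 2 =
     mu v * (mu u * F u ^+ 2) + mu u * (mu v * F v ^+ 2)
     - 2 * ((mu u * F u) * (mu v * F v)) by lra.
  under [RHS]eq_bigr do under eq_bigr do rewrite E.
  under [RHS]eq_bigr do rewrite sumrB big_split/= -mulr_suml -!mulr_sumr sum_mu mul1r.
  by rewrite sumrB big_split/= -mulr_suml sum_mu -mulr_sumr -mulr_suml /markov; lra.
have h0 u v : 0 <= mu u * mu v * (F u - F v) ^+ 2.
  by rewrite mulr_ge0 ?sqr_ge0// mulr_ge0// mu_ge0.
have uS : uniq S by exact: fset_uniq.
rewrite (bigD1_seq s)//=; rewrite (bigD1_seq t)//=.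
rewrite -addrA lerDl addr_ge0 ?sumr_ge0//.
by move=> u _; rewrite sumr_ge0.
Qed.

Definition sqnorm f := tsum (fun x => f x ^+ 2).

Lemma sqnorm_ge0 f : 0 <= sqnorm f.
Proof. by apply: tsum_ge0 => x; exact: sqr_ge0. Qed.

(** Sum [markov_defect] over all [x]: counting measure is left-invariant and [mu] has mass 1, so the
    averaged squares add up to [sqnorm f]. *)
Lemma translates_close f s t : finsupp f -> s \in S -> t \in S ->
  mu s * mu t * sqnorm (fun x => f (s^-1 * x)%g - f (t^-1 * x)%g) <=
  2 * (sqnorm f - sqnorm (markov f)).
Proof.
move=> ff sS tS; rewrite /sqnorm -tsumZ.
have fsq g : finsupp (fun x => f (g * x)%g ^+ 2).
  by apply: finsuppX; exact: finsupp_mull.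
have -> : tsum (fun x => f x ^+ 2) =
    tsum (fun x => \sum_(u <- S) mu u * f (u^-1 * x)%g ^+ 2).
  rewrite [RHS]tsum_sum => [|u]; last exact: finsuppMl.
  under [RHS]eq_bigr do rewrite tsumZ (tsum_mull (fun x => f x ^+ 2)).
  by rewrite -mulr_suml sum_mu mul1r.
have fm : finsupp (fun x => markov f x ^+ 2) by apply/finsuppX/finsupp_markov.
have fs : finsupp (fun x => \sum_(u <- S) mu u * f (u^-1 * x)%g ^+ 2).
  by apply: finsupp_sum => u; exact: finsuppMl.
rewrite -tsumB// -tsumZ; apply: ler_tsum => [||x]; last exact: markov_defect.
  by apply/finsuppMl/finsuppX/finsuppB; exact: finsupp_mull.
by apply/finsuppMl/finsuppB.
Qed.

Lemma supp_nonempty : exists s, s \in S.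
Proof.
have := sum_mu; case: S => [|s r _]; last by exists s; rewrite inE eqxx.
by rewrite big_nil => /eqP; rewrite eq_sym oner_eq0.
Qed.

Lemma sqnorm_markov_le f : finsupp f -> sqnorm (markov f) <= sqnorm f.
Proof.
move=> ff; have [s sS] := supp_nonempty.
(* With [t = s], [translates_close] bounds a nonnegative quantity by twice the loss of norm. *)
rewrite -subr_ge0 -(@pmulr_rge0 _ 2)//.
by apply: le_trans (translates_close ff sS sS); rewrite mulr_ge0 ?sqnorm_ge0// mulr_ge0 ?mu_ge0.
Qed.

(** If [sqnorm f] were 0, contraction would leave nothing strictly above the left-hand side. This
    licenses the division in [fmean]. *)
Lemma sqnorm_gt0 f eta : finsupp f ->
  (1 - eta ^+ 2) * sqnorm f < sqnorm (markov f) -> 0 < sqnorm f.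
Proof.
move=> ff hf; rewrite lt_def sqnorm_ge0 andbT; apply: contraTneq hf => N0.
by rewrite -leNgt N0 mulr0 (le_trans (sqnorm_markov_le ff))// N0.
Qed.

(** * Means with density [f ^+ 2 / sqnorm f] *)

Definition fmean f X : R := tsum (fun x => \1_X x * f x ^+ 2) / sqnorm f.

Definition ltrans (g : G) X : set G := [set (g * x)%g | x in X].

Lemma ltransE g X x : ltrans g X x = X (g^-1 * x)%g.
Proof.
apply/propext; split=> [[y Xy <-]|Xgx]; first by rewrite mulKg.
by exists (g^-1 * x)%g => //; rewrite mulVKg.
Qed.

Lemma ltransM g h X : ltrans g (ltrans h X) = ltrans (g * h)%g X.
Proof. by apply/funext => x; rewrite !ltransE invgM mulgA. Qed.

Lemma ltrans1 X : ltrans 1%g X = X.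
Proof. by apply/funext => x; rewrite ltransE invg1 mul1g. Qed.

Lemma indic_ltrans g X x : \1_(ltrans g X) (g * x)%g = \1_X x :> R.
Proof.
rewrite !indicE; congr (nat_of_bool _)%:R.
by apply/idP/idP => /set_mem; rewrite ?ltransE ?mulKg => Xx; apply/mem_set; rewrite ?ltransE ?mulKg.
Qed.

Lemma fmean_ltrans f g X :
  fmean f (ltrans g X) = tsum (fun x => \1_X x * f (g * x)%g ^+ 2) / sqnorm f.
Proof.
rewrite /fmean -(tsum_mull (fun x => \1_(ltrans g X) x * f x ^+ 2) g).
by congr (tsum _ / _); apply/funext => x; rewrite indic_ltrans.
Qed.

(** By [ler_sqrB] the difference costs [eta] times the norms plus [(2 * eta)^-1] times the squared
    distance of the translates. That distance is of order [eta ^+ 2] by [translates_close], so the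
    total is of order [eta]. *)
Lemma fmean_ltrans_close f s t X (eta : R) : finsupp f -> 0 < eta ->
  s \in S -> t \in S -> (1 - eta ^+ 2) * sqnorm f < sqnorm (markov f) ->
  fmean f (ltrans s^-1%g X) - fmean f (ltrans t^-1%g X) <=
  eta * (2 + (mu s * mu t)^-1).
Proof.
move=> ff eta0 sS tS hf.
have N0 : 0 < sqnorm f := sqnorm_gt0 ff hf.
have st0 : 0 < mu s * mu t by rewrite mulr_gt0// -mem_msupp.
rewrite !fmean_ltrans -mulrBl ler_pdivrMr//.
have fsq g : finsupp (fun x => f (g * x)%g ^+ 2).
  by apply: finsuppX; exact: finsupp_mull.
rewrite -tsumB; [|exact: finsuppMl|exact: finsuppMl].
set D := sqnorm (fun x => f (s^-1 * x)%g - f (t^-1 * x)%g).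
have fD : finsupp (fun x => (f (s^-1 * x)%g - f (t^-1 * x)%g) ^+ 2).
  by apply/finsuppX/finsuppB; exact: finsupp_mull.
apply: (@le_trans _ _ (eta * (sqnorm f + sqnorm f) + (2 * eta)^-1 * D)).
  have sqE g : sqnorm f = tsum (fun x => f (g * x)%g ^+ 2).
    by rewrite (tsum_mull (fun x => f x ^+ 2)).
  (* The two copies of [sqnorm f] are the norms of the two translates, so [ler_sqrB] can be summed
     pointwise. *)
  rewrite {1}(sqE s^-1%g) (sqE t^-1%g) -tsumD// /D /sqnorm -!tsumZ -tsumD; last 2 first.
  - by apply/finsuppMl/finsuppD.
  - exact: finsuppMl.
  apply: ler_tsum => [||x].
  - by apply: finsuppB; exact: finsuppMl.
  - by apply: finsuppD; apply: finsuppMl => //; exact: finsuppD.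
  set a := f _; set b := f _; rewrite -mulrBr.
  have h := ler_sqrB a b eta0.
  rewrite (le_trans _ h)// (le_trans (ler_norm _))// normrM ler_piMl//.
  by rewrite indicE; case: (_ \in _); rewrite ?normr1 ?normr0.
have DN : mu s * mu t * D <= 2 * (eta ^+ 2 * sqnorm f).
  by apply: le_trans (translates_close ff sS tS) _; lra.
have {}DN : D <= 2 * (eta ^+ 2 * sqnorm f) / (mu s * mu t).
  by rewrite ler_pdivlMr// mulrC.
have -> : eta * (2 + (mu s * mu t)^-1) * sqnorm f = eta * (sqnorm f + sqnorm f) +
   (2 * eta)^-1 * (2 * (eta ^+ 2 * sqnorm f) / (mu s * mu t)).
  set k := (mu s * mu t)^-1.
  have hk : (2 * eta)^-1 * (2 * eta) = 1 by rewrite mulVf// mulf_neq0// gt_eqF.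
  have -> : (2 * eta)^-1 * (2 * (eta ^+ 2 * sqnorm f) * k) =
    (2 * eta)^-1 * (2 * eta) * (eta * sqnorm f * k) by lra.
  by rewrite hk; lra.
by rewrite lerD2l ler_wpM2l// invr_ge0 mulr_ge0// ltW.
Qed.

Lemma fmean_ge0 f X : 0 <= fmean f X.
Proof.
by rewrite divr_ge0 ?sqnorm_ge0// tsum_ge0// => x; rewrite mulr_ge0 ?sqr_ge0.
Qed.

Lemma fmeanT f : sqnorm f != 0 -> fmean f [set: G] = 1.
Proof.
move=> N0; rewrite /fmean -[X in X / _](_ : sqnorm f = _) ?divff//.
by congr tsum; apply/funext => x; rewrite indicT mul1r.
Qed.

Lemma fmeanU f X Y : finsupp f -> X `&` Y = set0 ->
  fmean f (X `|` Y) = fmean f X + fmean f Y.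
Proof.
move=> ff XY0; rewrite /fmean -mulrDl -tsumD; last 2 first.
- exact/finsuppMl/finsuppX.
- exact/finsuppMl/finsuppX.
congr (_ / _); congr tsum; apply/funext => x; rewrite -mulrDl; congr (_ * _).
rewrite !indicE in_setU.
have : (x \in X) && (x \in Y) = false by rewrite -in_setI XY0 in_set0.
by case: (x \in X); case: (x \in Y); rewrite ?addr0 ?add0r.
Qed.

Lemma fmean_le1 f X : finsupp f -> sqnorm f != 0 -> fmean f X <= 1.
Proof.
move=> ff N0; rewrite -(fmeanT N0) -(setUv X) fmeanU ?setICr// lerDl.
exact: fmean_ge0.
Qed.

(** Compactness gives a cluster point. For a neighbourhood [V] of it, the ultrafilter contains the
    preimage of [V] or of its complement, and the latter contradicts clustering. *)
Lemma ultra_cvg_segment (U : set_system nat) (u : nat -> R) (a b : R) :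
  UltraFilter U -> (forall n, a <= u n <= b) -> exists l : R, u @ U --> l.
Proof.
move=> UU uab; have [|l [_ lU]] := @segment_compact R a b (u @ U) _.
   by apply: (@filterE _ U) => n /=; rewrite in_itv/= uab.
exists l => V lV; have [//|nV] := in_ultra_setVsetC (u @^-1` V) UU.
by have [x []] := lU (~` V) V nV lV.
Qed.

(* Amenability is read off an ultralimit of the means [f ^+ 2 / sqnorm f]; it is
   only invariant under the products [s^-1 * t] with [s], [t] in the support,
   a subgroup of index at most two, whence the final averaging. *)
Lemma almost_invariant_amenable :
  (forall k, exists f, finsupp f /\
     (1 - (k.+1%:R^-1) ^+ 2) * sqnorm f < sqnorm (markov f)) ->
  amenable R G.
Proof.
move=> /choice[F hF].
have N0 k : sqnorm (F k) != 0.
  by have [ff fk] := hF k; rewrite gt_eqF// (sqnorm_gt0 ff fk).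
have ff k : finsupp (F k) by have [] := hF k.
(* [U] refines the filter of cofinal segments, so [k.+1%:R^-1] still tends to 0 along it. *)
have [U [UU UN]] := ultraFilterLemma (@eventually_filter).
have /choice[m hm] : forall X, exists l : R, (fun k => fmean (F k) X) @ U --> l.
  by move=> X; apply: (@ultra_cvg_segment U _ 0 1) => // k; rewrite fmean_ge0 fmean_le1.
have uniqm X l : (fun k => fmean (F k) X) @ U --> l -> m X = l.
  by move=> h; apply: (cvg_unique _ (hm X) h) => //; exact: Rhausdorff.
have m0 X : 0 <= m X.
  by apply: (cvgr_to_ge (hm X)); apply: nearW => k; exact: fmean_ge0.
have mT : m [set: G] = 1.
  by apply: uniqm; under eq_fun do rewrite fmeanT//; exact: cvg_cst.
have mU X Y : X `&` Y = set0 -> m (X `|` Y) = m X + m Y.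
  move=> XY0; apply: uniqm; under eq_fun do rewrite fmeanU//.
  exact: cvgD (hm X) (hm Y).
have mle s t X : s \in S -> t \in S -> m (ltrans s^-1%g X) <= m (ltrans t^-1%g X).
  move=> sS tS; rewrite -subr_le0.
  have c0 : (fun k => k.+1%:R^-1 * (2 + (mu s * mu t)^-1) : R) @ U --> (0 : R).
    rewrite -(mul0r (2 + (mu s * mu t)^-1)); apply: cvgM; last exact: cvg_cst.
    by apply: cvg_trans (@cvg_harmonic R); exact: cvg_app.
  have cm : fmean (F k) (ltrans s^-1%g X) - fmean (F k) (ltrans t^-1%g X)
      @[k --> U] --> m (ltrans s^-1%g X) - m (ltrans t^-1%g X).
    exact: cvgB.
  apply: (ler_cvg_to cm c0); apply: nearW => k /=.
  by apply: fmean_ltrans_close => //; have [] := hF k.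
(* Exchanging [s] and [t] turns the inequality into an equality, and symmetry of the support removes
   the inverses. *)
have meq s t X : s \in S -> t \in S -> m (ltrans s X) = m (ltrans t X).
  move=> /msuppV sS /msuppV tS; apply/eqP; rewrite eq_le.
  by rewrite -(invgK s) -(invgK t) !mle.
have [s0 s0S] := supp_nonempty.
exists (fun X => (m X + m (ltrans s0 X)) / 2); split=> [X||X Y XY0|g X].
- by rewrite divr_ge0// addr_ge0.
- rewrite (_ : ltrans s0 setT = setT) ?mT ?divff//.
  by apply/funext => x; rewrite ltransE; apply/propext.
- have -> : ltrans s0 (X `|` Y) = ltrans s0 X `|` ltrans s0 Y.
    by apply/funext => x; rewrite /setU/= !ltransE.
  rewrite !mU//; first lra.
  rewrite -subset0 => x []; rewrite !ltransE => Xx Yx.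
  by have : (X `&` Y) (s0^-1 * x)%g by []; rewrite XY0.
pose H : {pred G} := [pred g : G | `[< forall X,
  m (ltrans g X) + m (ltrans s0 (ltrans g X)) = m X + m (ltrans s0 X) >]].
suff /asboolP/(_ X) : g \in H by rewrite /ltrans => ->.
have [_ _ _ _ gen] := mu_adm; apply: gen.
  split; first by apply/asboolP => Y; rewrite ltrans1.
  move=> x y /asboolP xH /asboolP yH; apply/asboolP => Y.
  by rewrite -ltransM xH -(yH (ltrans _ Y)) ltransM mulgV ltrans1.
move=> s /=; rewrite /msupp/= -mem_msupp => sS; apply/asboolP => Y.
(* The mean [m] does not see which letter of the support acts: [s Y] weighs as much as [s0 Y], and
   [s0 s Y] as much as [s^-1 s Y = Y]. Translation by [s] thus swaps the two terms of the
   average. *)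
rewrite (meq s s0)// (meq s0 s^-1%g (ltrans s Y))//; last exact: msuppV.
by rewrite ltransM mulVg ltrans1 addrC.
Qed.

Lemma kesten : ~ amenable R G -> exists2 r, 0 < r < 1 &
  forall f, finsupp f -> sqnorm (markov f) <= r * sqnorm f.
Proof.
move=> nam; apply: contrapT => nr; apply: nam; apply: almost_invariant_amenable => k.
(* The shift to [k.+2] keeps the ratio positive: [k.+1] would give 0 at [k = 0]. A function
   violating this bound is almost invariant for [k.+1] as well. *)
apply: contrapT => nf; apply: nr; exists (1 - (k.+2%:R^-1) ^+ 2).
  rewrite subr_gt0 gtrBl exprn_gt0 ?invr_gt0// andbT.
  by rewrite exprn_ilt1// invf_lt1// ltr1n.
move=> f ff; rewrite leNgt; apply/negP => hf; apply: nf; exists f; split=> //.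
apply: le_lt_trans hf; rewrite ler_wpM2r ?sqnorm_ge0// lerD2l lerN2.
by rewrite lerXn2r ?nnegrE ?invr_ge0// lef_pV2 ?posrE// ler_nat.
Qed.

(** * Decay of the transition probabilities *)

Definition transition n : G -> R := iter n markov (fun x => (x == 1%g)%:R).

Lemma finsupp_transition n : finsupp (transition n).
Proof.
elim: n => [|n IH]; last exact: finsupp_markov.
apply: (sub_finite_set _ (finite_set1 (1%g : G))) => x /=.
by case: eqP => // _; apply.
Qed.

(** A value is at most the l^2-norm. The square root appears because [r] bounds the ratio of squared
    norms. *)
Lemma transition_le r n g : 0 < r ->
  (forall f, finsupp f -> sqnorm (markov f) <= r * sqnorm f) ->
  transition n g <= Num.sqrt r ^+ n.
Proof.
move=> r0 hr; have N_le : sqnorm (transition n) <= r ^+ n.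
  elim: n => [|n IH]; last first.
    by rewrite exprS (le_trans (hr _ (finsupp_transition n)))// ler_wpM2l// ltW.
  rewrite expr0 /sqnorm (@tsum_fset _ _ _ [fset 1%g]%fset) => [|x].
    by rewrite big_seq_fset1 /= eqxx expr1n.
  by rewrite inE /= => /negPf ->; rewrite expr0n.
rewrite (le_trans (ler_norm _))// -ler_sqr ?nnegrE ?exprn_ge0 ?sqrtr_ge0//.
rewrite -normrX ger0_norm ?sqr_ge0// -exprM mulnC exprM sqr_sqrtr ?(ltW r0)//.
apply: le_trans N_le; apply: (@ler_tsum_term _ _ (fun x => transition n x ^+ 2)).
  exact/finsuppX/finsupp_transition.
by move=> y; exact: sqr_ge0.
Qed.

(** * Words and the Green function *)

Fixpoint words_of_size n : seq (seq G) :=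
  if n is n'.+1 then [seq s :: w | s <- S, w <- words_of_size n'] else [:: [::]].

Lemma words_of_size_uniq n : uniq (words_of_size n).
Proof.
elim: n => //= n IH; apply: allpairs_uniq => //; first exact: fset_uniq.
by move=> [s w] [t v] _ _ /= [-> ->].
Qed.

Lemma mem_words_of_size n w :
  (w \in words_of_size n) = (size w == n) && all (mem S) w.
Proof.
elim: n w => [|n IH] [|s w] //=.
  by apply/allpairsP => -[[t v] []].
apply/allpairsP/idP => [[[t v] /= [tS + [-> ->]]]|].
  by rewrite IH eqSS => /andP[-> ->]; rewrite andbT.
by rewrite eqSS => /and3P[sw sS wS]; exists (s, w); rewrite IH sw.
Qed.

(** Each application of [markov] prepends a letter: [s :: w] evaluates to [g] exactly when [w]
    evaluates to [s^-1 * g]. *)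
Lemma transitionE n g :
  transition n g = \sum_(w <- words_of_size n | word_eval w == g) weight mu w.
Proof.
elim: n g => [|n IH] g /=.
  by rewrite big_mkcond big_seq1 /word_eval /weight !big_nil eq_sym; case: eqP.
rewrite /markov [RHS]big_mkcond [RHS]big_allpairs_dep; apply: eq_bigr => s _.
rewrite -[RHS]big_mkcond/= -/(transition n) IH mulr_sumr; apply: eq_big => [w|w _].
  by rewrite /word_eval big_cons -(inj_eq (mulgI s)) mulVKg.
by rewrite /weight big_cons.
Qed.

Lemma wordsE w : words mu w <-> all (mem S) w.
Proof.
by split=> [ww|/allP ww s /ww]; [apply/allP => s /ww|]; rewrite /msupp/= mem_msupp.
Qed.

Lemma weight_ge0 w : 0 <= weight mu w.
Proof. by apply: prodr_ge0 => s _; exact: mu_ge0. Qed.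

Lemma sum_weight_le (A : {fset seq G}) n g :
  [set` A] `<=` word_fiber mu g ->
  \sum_(w <- A | size w == n) weight mu w <= transition n g.
Proof.
move=> Ag; rewrite transitionE -big_filter -[leRHS]big_filter.
rewrite [leRHS](bigID (mem A))/= -[leLHS]addr0 lerD//; last first.
  by apply: sumr_ge0 => w _; exact: weight_ge0.
rewrite -[leRHS]big_filter le_eqVlt; apply/orP; left; apply/eqP/perm_big.
rewrite uniq_perm ?filter_uniq ?fset_uniq ?words_of_size_uniq// => w.
rewrite !mem_filter mem_words_of_size.
apply/idP/idP => [/andP[-> wA]|/and3P[wA _ /andP[-> _]]]; last by rewrite wA.
by have [/wordsE -> /= ->] := Ag _ wA; rewrite eqxx wA.
Qed.

(** Group the words by length and compare with the geometric series starting at [M]. The maximal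
    length [K] makes the set of lengths finite. *)
Lemma sum_weight_tail_le (A : {fset seq G}) M g rho : 0 < rho < 1 ->
  (forall n, transition n g <= rho ^+ n) ->
  [set` A] `<=` word_fiber mu g -> (forall w, w \in A -> (M <= size w)%N) ->
  \sum_(w <- A) weight mu w <= rho ^+ M / (1 - rho).
Proof.
move=> /andP[rho0 rho1] hrho Ag AM; set K := \max_(w <- A) size w.
have AK w : w \in A -> (size w < K.+1)%N.
  by move=> wA; rewrite ltnS; exact: leq_bigmax_seq.
rewrite big_seq (partition_big (fun w => inord (size w) : 'I_K.+1)
  (fun n : 'I_K.+1 => (M <= n)%N))/=; last first.
  by move=> w wA; rewrite inordK ?AM ?AK.
apply: (@le_trans _ _ (\sum_(n < K.+1 | (M <= n)%N) rho ^+ n)).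
  apply: ler_sum => n _; apply: le_trans (hrho n).
  apply: le_trans (sum_weight_le n Ag).
  rewrite [leRHS]big_seq_cond le_eqVlt; apply/orP; left; apply/eqP/eq_bigl => w.
  by case: (boolP (w \in A)) => //= wA; rewrite -val_eqE/= inordK ?AK.
rewrite -(big_geq_mkord _ _ xpredT (fun n => rho ^+ n)).
have [MK|KM] := leqP M K.+1; last first.
  by rewrite big_geq 1?ltnW// divr_ge0 ?exprn_ge0 ?subr_ge0// ltW.
rewrite -(subnKC MK) geometric_partial_tail geometric_le_lim ?exprn_ge0 ?(ltW rho0)//.
by rewrite ger0_norm// ltW.
Qed.

Lemma word_eval_cat (v w : seq G) : word_eval (v ++ w) = (word_eval v * word_eval w)%g.
Proof. by rewrite /word_eval big_cat. Qed.

(** Reverse the word and invert its letters, which stay in the symmetric support. This gives the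
    closure under quotients needed in [word_fiber_nonempty]. *)
Lemma wordsV w : words mu w ->
  exists2 v, words mu v & word_eval v = (word_eval w)^-1%g.
Proof.
elim: w => [_|s w IH sw].
  by exists [::] => //; rewrite /word_eval big_nil invg1.
have [v vS vE] : exists2 v, words mu v & word_eval v = (word_eval w)^-1%g.
  by apply: IH => t tw; apply: sw; rewrite inE tw orbT.
exists (v ++ [:: s^-1%g]).
  move=> t; rewrite mem_cat => /orP[/vS//|]; rewrite inE => /eqP ->.
  have : s \in S by rewrite mem_msupp; apply: sw; rewrite inE eqxx.
  by move/msuppV; rewrite mem_msupp.
by rewrite word_eval_cat vE /word_eval big_seq1 big_cons invgM.
Qed.

Lemma word_fiber_nonempty g : exists w, word_fiber mu g w.
Proof.
have [_ _ _ _ gen] := mu_adm.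
pose H : {pred G} := [pred g : G | `[< exists w, word_fiber mu g w >]].
suff /asboolP : g \in H by [].
apply: gen => [|s sS]; last first.
  apply/asboolP; exists [:: s]; split=> [t|]; first by rewrite inE => /eqP ->.
  by rewrite /= /word_eval big_seq1.
split; first by apply/asboolP; exists [::]; split=> //=; rewrite /word_eval big_nil.
move=> x y /asboolP[v [vS vx]] /asboolP[w [wS wy]]; apply/asboolP.
have [u uS uE] := wordsV wS; exists (v ++ u); split=> [s|].
  by rewrite mem_cat => /orP[/vS|/uS].
by rewrite /= word_eval_cat uE vx wy.
Qed.

(** Every fibre is nonempty, so a minimal length exists and [word_norm] never takes its default
    value. *)
Lemma word_normP g : exists2 w, word_fiber mu g w & size w = word_norm mu g.
Proof.
suff [n nP] : exists n, [set n | (exists2 w, word_fiber mu g w & size w = n) /\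
    (forall w, word_fiber mu g w -> (n <= size w)%N)] n.
  by have [] := xgetPex 0%N (ex_intro _ n nP).
have hex : exists n, `[< exists2 w, word_fiber mu g w & size w = n >].
  by have [w gw] := word_fiber_nonempty g; exists (size w); apply/asboolP; exists w.
case: (ex_minnP hex) => n /asboolP nw nmin; exists n; split=> // w gw.
by apply: nmin; apply/asboolP; exists w.
Qed.

(** The support is finite. Starting the minimum at 1 ensures [e <= 1], so that powers of [e]
    decrease. *)
Lemma mu_lbound : exists2 e, 0 < e <= 1 & forall s, s \in S -> e <= mu s.
Proof.
have : forall s, s \in S -> 0 < mu s by move=> s; rewrite mem_msupp.
elim: S => [_|s r IH rS]; first by exists 1; rewrite ?ltr01 ?lexx.
have [|e /andP[e0 e1] er] := IH; first by move=> t tr; rewrite rS// inE tr orbT.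
exists (Num.min e (mu s)) => [|t].
  by rewrite lt_min e0 rS ?inE ?eqxx// ge_min e1.
by rewrite inE ge_min => /predU1P[->|/er ->//]; rewrite lexx orbT.
Qed.

Lemma weight_lbound e w : 0 <= e -> (forall s, s \in S -> e <= mu s) ->
  words mu w -> e ^+ size w <= weight mu w.
Proof.
move=> e0 he /wordsE; elim: w => [|s w IH] /=; first by rewrite /weight big_nil.
move=> /andP[sS wS]; rewrite /weight big_cons exprS ler_pM ?exprn_ge0//.
  exact: he.
exact: IH.
Qed.

Lemma esum_fin_le (I : choiceType) (A : set I) (a : I -> R) (c : R) :
  (forall F : {fset I}, [set` F] `<=` A -> \sum_(i <- F) a i <= c) ->
  (\esum_(i in A) (a i)%:E <= c%:E)%E.
Proof.
move=> h; apply: ge_ereal_sup => _ [X [/finite_fsetP[F ->] FA] <-].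
by rewrite -fsbig_seq ?fset_uniq// sumEFin lee_fin; exact: h.
Qed.

(** * Tail bounds for the path measures *)

Section Tails.
Variables (rho e : R).
Hypotheses (rho01 : 0 < rho < 1) (e01 : 0 < e <= 1).
Hypothesis hrho : forall n g, transition n g <= rho ^+ n.
Hypothesis he : forall s, s \in S -> e <= mu s.

Lemma Green_lty g : (Green mu g < +oo)%E.
Proof.
(* The whole Green function is the tail with [M = 0]. *)
apply: (@le_lt_trans _ _ (rho ^+ 0 / (1 - rho))%:E); last exact: ltry.
by apply: esum_fin_le => F Fg; exact: (sum_weight_tail_le rho01 (hrho^~ g)).
Qed.

(** A single shortest word for [g] already contributes this much. *)
Lemma Green_lbound g : ((e ^+ word_norm mu g)%:E <= Green mu g)%E.
Proof.
have [w gw <-] := word_normP g; apply: esum_ge; exists [set w].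
  by split=> [|_ ->]; first exact: finite_set1.
have /andP[e0 _] := e01; have [wS _] := gw.
by rewrite fsbig_set1 lee_fin weight_lbound// ltW.
Qed.

Lemma path_prob_le g (E : set (seq G)) M N : (word_norm mu g <= N)%N ->
  (forall w, E w -> (M <= size w)%N) ->
  (path_prob mu g E <= (rho ^+ M / (1 - rho) / e ^+ N)%:E)%E.
Proof.
move=> gN EM; have /andP[e0 e1] := e01.
have := Green_lbound g; have := Green_lty g; rewrite /path_prob.
case: (Green mu g) => [c _|//|//]; rewrite lee_fin => ec.
have c0 : 0 < c by apply: lt_le_trans ec; rewrite exprn_gt0.
under eq_esum do rewrite inver gt_eqF// -EFinM.
apply: esum_fin_le => F FE; rewrite -mulr_suml.
have tail : \sum_(w <- F) weight mu w <= rho ^+ M / (1 - rho).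
  by apply: (sum_weight_tail_le rho01 (hrho^~ g)) => w => [/FE[]//|/FE[_ /EM]].
apply: ler_pM => //.
- by rewrite sumr_ge0// => w _; exact: weight_ge0.
- by rewrite invr_ge0 ltW.
rewrite lef_pV2 ?posrE ?exprn_gt0//; apply: le_trans ec.
by rewrite ler_wiXn2l// ltW.
Qed.

(* As [1 <= c], one may replace [c] by its integer part. *)
Lemma path_prob_scaled_le g (D : nat) (c q : R) :
  1 <= c -> (word_norm mu g)%:R <= c -> q <= 1 ->
  rho ^+ D / (1 - rho) / e <= q ->
  (path_prob mu g [set w | (D%:R * c <= (size w)%:R)%R] <= q%:E)%E.
Proof.
move=> c1 gc q1 hq; have /andP[e0 e1] := e01; have /andP[r0 r1] := rho01.
have c0 : 0 <= c by exact: le_trans c1.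
have /andP[Nc cN] := truncn_itv c0; set N := Num.truncn c in Nc cN.
have N1 : (0 < N)%N by rewrite truncn_gt0.
have gN : (word_norm mu g <= N)%N by rewrite truncn_ge_nat.
apply: (le_trans (@path_prob_le g _ (D * N) N gN _)) => [w /= h|].
  by rewrite -(ler_nat R) natrM (le_trans _ h)// ler_wpM2l.
rewrite lee_fin exprM mulrAC -expr_div_n.
have x0 : 0 <= rho ^+ D / e by rewrite divr_ge0 ?exprn_ge0// ltW.
have d1 : 1 <= (1 - rho)^-1 by rewrite invf_ge1 ?subr_gt0// gerBl ltW.
rewrite mulrAC in hq.
(* The bound is the [N]-th power of [rho ^+ D / e], divided by [1 - rho]. As this base is at most 1
   and [N] is positive, the exponent can be lowered to 1. *)
have x1 : rho ^+ D / e <= 1.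
  by apply: le_trans q1; apply: le_trans hq; rewrite ler_peMr.
apply: le_trans hq; rewrite ler_wpM2r ?invr_ge0 ?subr_ge0 ?(ltW r1)//.
by rewrite -[leRHS]expr1 ler_wiXn2l.
Qed.

End Tails.
End Kesten.

(** * Elementary estimates and choice of the constants *)

Lemma bernoulli_ineq {R : realFieldType} (h : R) n :
  0 <= h -> 1 + n%:R * h <= (1 + h) ^+ n.
Proof.
move=> h0; elim: n => [|n IH]; first by rewrite mul0r addr0.
have h1 : 0 <= 1 + h by lra.
have nh : 0 <= n%:R * h ^+ 2 by rewrite mulr_ge0 ?sqr_ge0.
rewrite exprS; apply: le_trans (ler_wpM2l h1 IH); rewrite -natr1; lra.
Qed.

(** Write [rho^-1 = 1 + h]. Squaring Bernoulli's inequality for the exponent [k] gives quadratic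
    growth at the exponent [2 * k], which beats the linear factor. *)
Lemma lin_geometric_small {R : archiRealFieldType} (rho D : R) :
  0 < rho < 1 -> 0 < D -> exists2 n, (0 < n)%N & D * n.+1%:R * rho ^+ n <= 1.
Proof.
move=> /andP[r0 r1] D0; set h := rho^-1 - 1.
have h0 : 0 < h by rewrite subr_gt0 invf_gt1.
(* The 3 comes from [2 * k + 1 <= 3 * k] for [k = m.+1]; then [3 * D * k] is at most
   [(k * h) ^+ 2]. *)
have [m hm] : exists m : nat, 3 * D / h ^+ 2 <= m.+1%:R.
  exists (Num.truncn (3 * D / h ^+ 2)); apply: ltW; exact: truncnS_gt.
exists (m.+1 * 2)%N => //; set k : R := m.+1%:R.
have k1 : 1 <= k by rewrite ler1n.
rewrite ler_pdivrMr ?exprn_gt0// in hm.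
have b : (1 + k * h) * rho ^+ m.+1 <= 1.
  rewrite -ler_pdivlMr ?exprn_gt0// div1r -exprVn.
  by rewrite (le_trans (bernoulli_ineq _ (ltW h0)))// /h addrC subrK.
have b2 : ((1 + k * h) * rho ^+ m.+1) ^+ 2 <= 1.
  by rewrite expr_le1// mulr_ge0 ?exprn_ge0 ?(ltW r0)// addr_ge0// mulr_ge0// ltW.
apply: le_trans b2; rewrite exprMn -exprM ler_wpM2r ?exprn_ge0 ?(ltW r0)//.
rewrite -natr1 natrM -/k.
have := ler_wpM2l (ltW (lt_le_trans ltr01 k1)) hm.
have : 0 <= k * h by rewrite mulr_ge0 ?(ltW h0)// (le_trans _ k1).
have : D <= D * k by rewrite ler_peMr// ltW.
lra.
Qed.

Theorem mainTheorem6 (R : realType) (G : groupType) (mu : G -> R)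
    (mu_adm : admissible mu) (G_nonam : ~ amenable R G) :
  exists A a B b : R,
    [/\ 0 < A, 0 < a < 1, 0 < B, 0 < b < 1 - a & condB mu A a B b].
Proof.
have [r /andP[r0 r1] hr] := kesten mu_adm G_nonam.
have [e e01 he] := mu_lbound mu_adm; have /andP[e0 e1] := e01.
set rho := Num.sqrt r.
have rho0 : 0 < rho by rewrite sqrtr_gt0.
have rho1 : rho < 1 by rewrite -sqrtr1 ltr_sqrt.
have rho01 : 0 < rho < 1 by rewrite rho0.
have hrho n g : transition mu n g <= rho ^+ n := transition_le n g r0 hr.
have tail := path_prob_scaled_le mu_adm rho01 e01 hrho he.
set C := ((1 - rho) * e)^-1.
have C0 : 0 < C by rewrite invr_gt0 mulr_gt0// subr_gt0.
have CE D : rho ^+ D / (1 - rho) / e = C * rho ^+ D.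
  by rewrite -mulrA -invfM mulrC.
(* This gives [C * rho ^+ A <= 1/2], the value of [a]; here [A.+1] is only bounded below by 1. *)
have [A A1 hA] := lin_geometric_small rho01 (mulr_gt0 (ltr0Sn R 1) C0).
have A0 : 0 < A%:R :> R by rewrite ltr0n.
(* With [b = 1/4] the target is [1 / (8 * (A * B + B + 2))], and [A * B + B + 2] is at most
   [(A + 2) * (B + 1)]. This is linear in [B] once [A] is fixed. *)
have D0 : 0 < 8 * (A%:R + 2) * C by rewrite !mulr_gt0// addr_gt0.
have [B B1 hB] := lin_geometric_small rho01 D0.
have B0 : 0 < B%:R :> R by rewrite ltr0n.
have AB0 : 0 < A%:R * B%:R :> R by rewrite mulr_gt0.
exists A%:R, (2^-1), B%:R, (4^-1).
have h2 : 0 < (2^-1 : R) < 1 by lra.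
have h4 : 0 < (4^-1 : R) < 1 - 2^-1 by lra.
have /andP[b0 b1] := h4.
split=> //; split=> //.
  split=> // [g|c g c1 gc]; first exact: (Green_lty mu_adm rho01 hrho).
  apply: tail => //; first lra.
  rewrite CE.
  have : 2 * C * 1 * rho ^+ A <= 2 * C * A.+1%:R * rho ^+ A.
    by rewrite ler_wpM2r ?exprn_ge0 ?(ltW rho0)// ler_wpM2l ?ler1n// mulr_ge0// ltW.
  lra.
move=> c g c1 gc; apply: tail => //.
  (* This is the requirement [q <= 1] of the tail bound. *)
  rewrite ler_pdivrMr; lra.
rewrite CE ler_pdivlMr; last lra.
set x := C * rho ^+ B; have x0 : 0 <= x by rewrite mulr_ge0 ?exprn_ge0 ?(ltW rho0)// ltW.
have : x * (A%:R * B%:R + B%:R + 2) <= x * ((A%:R + 2) * (B%:R + 1)).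
  by rewrite ler_wpM2l//; lra.
have : 8 * (x * ((A%:R + 2) * (B%:R + 1))) <= 1.
  by apply: le_trans hB; rewrite -natr1 /x; lra.
lra.
Qed.
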